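(* Consider an affine resource theory, with free sets $\mathcal F$ on the input space and $\mathcal F'$ on the output space. For states $\rho$ (input) and $\rho'$ (output), there exists a resource--non-generating probabilistic transformation $\rho\to\rho'$ (in the sense defined below) if any of the following holds: (i) $\infty>\Omega_{\mathcal F}(\rho)\ge\Omega_{\mathcal F'}(\rho')$; (ii) $\Omega_{\mathcal F}(\rho)=\infty$ and $R_{\mathcal F'}(\rho')<\infty$; (iii) $R_{\mathcal F}(\rho)=\infty$.
   Context: Finite dimensions; $A\le B$ means $B-A\ge0$; $\langle A,B\rangle=\mathrm{Tr}(AB)$. Each space carries a closed convex set of free states $\mathcal F$ (density operators). The theory is affine: on each space $\mathcal F=\mathrm{aff}(\mathcal F)\cap\mathcal D$, where $\mathcal D$ is the set of density operators and $\mathrm{aff}$ is the affine hull. $R_{\max}(X\|Y)=\inf\{\lambda:X\le\lambda Y\}$ (with $\inf\emptyset=\infty$); $R_{\mathcal F}(\rho)=\min_{\sigma\in\mathcal F}R_{\max}(\rho\|\sigma)$; $\Omega_{\mathcal F}(\rho)=\inf_{\sigma\in\mathcal F}R_{\max}(\rho\|\sigma)R_{\max}(\sigma\|\rho)$. $\mathbb O$ is the set of completely positive trace-non-increasing maps $\mathcal E$ from input to output operators such that for every $\sigma\in\mathcal F$ there exist $\sigma'\in\mathcal F'$ and $p\in[0,1]$ with $\mathcal E(\sigma)=p\sigma'$. A probabilistic transformation $\rho\to\rho'$ exists iff $\rho'$ lies in the closure of $\{\mathcal E(\rho)/\mathrm{Tr}\,\mathcal E(\rho):\ \mathcal E\in\mathbb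 O,\ \mathrm{Tr}\,\mathcal E(\rho)>0\}$. *)

(* Defs.v *)
From HB Require Import structures.
From mathcomp Require Import all_boot all_order all_algebra.
From mathcomp Require Import boolp classical_sets reals constructive_ereal ereal
  topology normedtype sequences.
From mathcomp Require Import complex.
Import numFieldNormedType.Exports.

Set Implicit Arguments.
Unset Strict Implicit.
Unset Printing Implicit Defensive.

Import Order.TTheory GRing.Theory Num.Theory.
Local Open Scope ring_scope.
Local Open Scope classical_set_scope.

Section QRT.
Variable R : realType.
Local Notation C := R[i].

Local Notation op n := 'M[C]_n.

(* Positive semidefiniteness of a kernel indexed by a finite type:
   <v, A v> >= 0 for all vectors v (in the order of C, this forces the
   quadratic form to be real and nonnegative). *)
Definition psdf (T : finType) (A : T -> T -> C) : Prop :=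
  forall v : T -> C, 0 <= \sum_(i : T) \sum_(j : T) (v i)^* * A i j * v j.

Definition psd n (A : op n) : Prop := psdf (fun i j => A i j).

Definition loewner n (A B : op n) : Prop := psd (B - A).

Definition density n (A : op n) : Prop := psd A /\ \tr A = 1.

Definition rsc n (l : R) (A : op n) : op n := (l%:C)%C *: A.

Definition aff n (F : set (op n)) : set (op n) :=
  [set X | exists (k : nat) (c : 'I_k -> R) (s : 'I_k -> op n),
     (forall i, F (s i)) /\ \sum_(i < k) c i = 1 /\
     X = \sum_(i < k) rsc (c i) (s i)].

Definition convex_set n (F : set (op n)) : Prop :=
  forall X Y (t : R), F X -> F Y -> 0 <= t <= 1 ->
    F (rsc t X + rsc (1 - t) Y).

(* Entrywise convergence of a sequence of operators (real and imaginary
   parts of each entry converge); this is the usual topology of the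
   finite-dimensional operator space. *)
Definition op_cvg n (u : nat -> op n) (X : op n) : Prop :=
  forall i j,
    ((fun k => complex.Re (u k i j)) : R^nat) @ \oo --> (complex.Re (X i j) : R) /\
    ((fun k => complex.Im (u k i j)) : R^nat) @ \oo --> (complex.Im (X i j) : R).

Definition op_closure n (S : set (op n)) : set (op n) :=
  [set X | exists u : nat -> op n, (forall k, S (u k)) /\ op_cvg u X].

Definition closed_set n (F : set (op n)) : Prop := op_closure F `<=` F.

Definition affine_free_set n (F : set (op n)) : Prop :=
  F !=set0 /\ closed_set F /\ convex_set F /\
  (forall X, F X -> density X) /\
  (forall X, F X <-> (aff F X /\ density X)).

(* R_max(X||Y) = inf {lambda : X <= lambda Y}, inf of empty = +oo. *)
Definition Rmax n (X Y : op n) : \bar R :=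
  ereal_inf [set (l%:E)%E | l in [set l : R | loewner X (rsc l Y)]].

Definition RF n (F : set (op n)) (rho : op n) : \bar R :=
  ereal_inf [set Rmax rho s | s in F].

Definition OmegaF n (F : set (op n)) (rho : op n) : \bar R :=
  ereal_inf [set (Rmax rho s * Rmax s rho)%E | s in F].

(* Complete positivity: for every k, id_k (x) E maps positive operators on
   C^k (x) C^n (block kernels indexed by 'I_k * 'I_n) to positive ones. *)
Definition completely_positive n m (E : op n -> op m) : Prop :=
  forall (k : nat) (B : 'I_k -> 'I_k -> op n),
    psdf (fun (p q : 'I_k * 'I_n) => B p.1 q.1 p.2 q.2) ->
    psdf (fun (p q : 'I_k * 'I_m) => E (B p.1 q.1) p.2 q.2).

Definition linear_map n m (E : op n -> op m) : Prop :=
  forall (a : C) (X Y : op n), E (a *: X + Y) = a *: E X + E Y.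

Definition trace_nonincreasing n m (E : op n -> op m) : Prop :=
  forall X : op n, psd X -> \tr (E X) <= \tr X.

Definition free_ops n m (F : set (op n)) (F' : set (op m)) :
    set (op n -> op m) :=
  [set E | linear_map E /\ completely_positive E /\ trace_nonincreasing E /\
     forall s, F s -> exists s' (p : R), F' s' /\ 0 <= p <= 1 /\
       E s = rsc p s'].

Definition prob_transformation n m (F : set (op n)) (F' : set (op m))
    (rho : op n) (rho' : op m) : Prop :=
  op_closure [set (\tr (E rho))^-1 *: E rho |
                E in [set E | free_ops F F' E /\ 0 < \tr (E rho)]] rho'.

End QRT.

(* Main.v *)
Require Import Defs.
From HB Require Import structures.
From mathcomp Require Import all_boot all_order all_algebra.
From mathcomp Require Import boolp classical_sets reals constructive_ereal ereal
  topology normedtype sequences.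
From mathcomp Require Import complex.
From mathcomp Require Import ring lra.

Set Implicit Arguments.
Unset Strict Implicit.

Import numFieldNormedType.Exports.
Import Order.TTheory GRing.Theory Num.Theory.
Local Open Scope ring_scope.
Local Open Scope classical_set_scope.
Local Open Scope sesquilinear_scope.

(* For an affine theory the free cone is the psd part of L = span F, so
   Omega_F(rho) is the least w admitting Y in L with rho <= Y <= w rho. The cone
   of pairs (Y - P, - Y - Q), with Y in L and P, Q psd, is closed; separating
   (rho, - w rho) from it gives, for each w < Omega_F(rho), psd operators A, B
   that agree on F and satisfy <A, rho> > w <B, rho>. The measure-and-prepare map
   X |-> <A, X> P + <B, X> Q with P = tau - x s', Q = y s' - tau and s' free then
   sends free states to multiples of s', and rho to a multiple of
   (a - b) tau + (b y - a x) s' where a = <A, rho>, b = <B, rho>. Cases (i) and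
   (ii) follow by choosing tau, x, y so that the s' term is absent or negligible.
   When R_F(rho) is infinite, a free state s0 of maximal support has a kernel
   vector v with <v, rho v> > 0, and X |-> <v, X v> rho' annihilates F. *)

(** * Positive semidefinite matrices: forms, Gram factors, trace bounds *)

Lemma adjmxM (R : realType) m n p (A : 'M[R[i]]_(m, n)) (B : 'M[R[i]]_(n, p)) :
  (A *m B) ^t* = B ^t* *m A ^t*.
Proof. by rewrite trmx_mul map_mxM. Qed.

Lemma adjmxD (R : realType) m n (A B : 'M[R[i]]_(m, n)) :
  (A + B) ^t* = A ^t* + B ^t*.
Proof. by rewrite raddfD /= map_mxD. Qed.

Lemma adjmxZ (R : realType) m n (a : R[i]) (A : 'M[R[i]]_(m, n)) :
  (a *: A) ^t* = a^* *: A ^t*.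
Proof. by rewrite linearZ /= map_mxZ. Qed.

Lemma qformE (R : realType) n (A : 'M[R[i]]_n) (v : 'cV[R[i]]_n) :
  (v ^t* *m A *m v) 0 0 =
  \sum_(i < n) \sum_(j < n) (v i 0)^* * A i j * v j 0.
Proof.
rewrite -mulmxA mxE; apply: eq_bigr => i _; rewrite !mxE mulr_sumr.
by apply: eq_bigr => j _; rewrite mulrA.
Qed.

Lemma psdP (R : realType) n (A : 'M[R[i]]_n) :
  psd A <-> forall v : 'cV[R[i]]_n, 0 <= (v ^t* *m A *m v) 0 0.
Proof.
split=> [pA v|pA v]; first by rewrite qformE; exact: pA.
have := pA (\col_i v i); rewrite qformE.
by under eq_bigr do under eq_bigr do rewrite !mxE.
Qed.

Lemma adjmx_self_trace_ge0 (R : realType) m n (Z : 'M[R[i]]_(m, n)) :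
  0 <= \tr (Z ^t* *m Z).
Proof.
apply: sumr_ge0 => i _; rewrite mxE; apply: sumr_ge0 => j _.
by rewrite !mxE -normCKC exprn_ge0.
Qed.

Lemma trace_mx11 (R : realType) (Z : 'M[R[i]]_1) : \tr Z = Z 0 0.
Proof. by rewrite /mxtrace big_ord1. Qed.

Lemma psd_gramR (R : realType) m n (U : 'M[R[i]]_(m, n)) : psd (U ^t* *m U).
Proof.
apply/psdP => v; rewrite !mulmxA -adjmxM -mulmxA -trace_mx11.
exact: adjmx_self_trace_ge0.
Qed.

Lemma mx_entryE (R : realType) n (A : 'M[R[i]]_n) (i j : 'I_n) :
  ((delta_mx i 0 : 'cV[R[i]]_n) ^t* *m A *m (delta_mx j 0 : 'cV[R[i]]_n)) 0 0
    = A i j.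
Proof.
rewrite -mulmxA -colE trmx_delta.
have -> : map_mx Num.conj (delta_mx (0 : 'I_1) i : 'rV[R[i]]_n) = delta_mx 0 i.
  by rewrite map_delta_mx.
by rewrite -rowE !mxE.
Qed.

(* Polarization: evaluate the form at e_i + z e_j for z = 1 and z = 'i. *)
Lemma qform_eq0 (R : realType) n (D : 'M[R[i]]_n) :
  (forall v : 'cV[R[i]]_n, (v ^t* *m D *m v) 0 0 = 0) -> D = 0.
Proof.
move=> D0.
have Dij i j (z : R[i]) : z * D i j + z^* * D j i = 0.
  have := D0 (delta_mx i 0 + z *: delta_mx j 0).
  rewrite adjmxD adjmxZ !mulmxDl !mulmxDr -!scalemxAl -!scalemxAr.
  have -> (M1 M2 M3 M4 : 'M[R[i]]_1) :
    (M1 + z *: M2 + (z^* *: M3 + z^* *: (z *: M4))) 0 0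
     = M1 0 0 + z * M2 0 0 + (z^* * M3 0 0 + z^* * (z * M4 0 0)).
    by rewrite !mxE.
  by rewrite !D0 !mx_entryE => <-; ring.
apply/matrixP => i j; rewrite [RHS]mxE.
have := Dij i j 1; have := Dij i j 'i; rewrite conjCi rmorph1 !mul1r.
rewrite mulNr -mulrBr => /eqP; rewrite mulf_eq0 (negPf (neq0Ci _)) /= subr_eq0.
by move=> /eqP <- /eqP; rewrite -mulr2n mulrn_eq0 /= => /eqP.
Qed.

(** Nonnegativity in the order of [C] makes the form real, so [A] and its adjoint have the same
    form, and [qform_eq0] kills their difference. *)
Lemma psd_herm (R : realType) n (A : 'M[R[i]]_n) : psd A -> A ^t* = A.
Proof.
move=> /psdP pA; apply/esym/eqP; rewrite -subr_eq0; apply/eqP/qform_eq0 => v.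
have qreal : (v ^t* *m A *m v) 0 0 = (v ^t* *m A ^t* *m v) 0 0.
  have /ger0_real/CrealP <- := pA v.
  have -> : ((v ^t* *m A *m v) 0 0)^* = ((v ^t* *m A *m v) ^t*) 0 0.
    by rewrite !mxE.
  by rewrite !adjmxM trmxCK mulmxA.
rewrite mulmxBr mulmxBl.
have -> (M N : 'M[R[i]]_1) : (M - N) 0 0 = M 0 0 - N 0 0 by rewrite !mxE.
by rewrite -qreal subrr.
Qed.

(** Spectral theorem: in [A = P^* D P] the eigenvalues are values of the form, hence nonnegative,
    and [U] is [sqrt(D) P]. *)
Lemma psd_gram (R : realType) n (A : 'M[R[i]]_n) :
  psd A -> exists U : 'M[R[i]]_n, A = U ^t* *m U.
Proof.
move=> pA; have hA := psd_herm pA.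
have /hermitian_normalmx/orthomx_spectralP : A \is hermsymmx.
  by apply/is_hermitianmxP; rewrite expr0 scale1r hA.
set P := spectralmx A; set d := spectral_diag A => AE.
have PU : P \is unitarymx by exact: spectral_unitarymx.
rewrite (invmx_unitary PU) in AE.
have d_ge0 i : 0 <= d 0 i.
  have /psdP/(_ (P ^t* *m delta_mx i 0)) := pA.
  rewrite adjmxM trmxCK AE !mulmxA.
  by rewrite !(mulmxtVK _ PU) mx_entryE mxE eqxx.
exists (diag_mx (map_mx sqrtC d) *m P).
rewrite adjmxM mulmxA -(mulmxA (P ^t*)) tr_diag_mx map_diag_mx mulmx_diag {1}AE.
congr (_ *m diag_mx _ *m _); apply/rowP => i; rewrite !mxE /=.
have /CrealP -> : sqrtC (d 0 i) \is Num.real by rewrite ger0_real ?sqrtC_ge0.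
by rewrite -expr2 sqrtCK.
Qed.

(** With Gram factors [U] of [A] and [W] of [X], cyclicity makes the trace that of [Z^* Z] for
    [Z = U W^*]. *)
Lemma psd_trace_mul (R : realType) n (A X : 'M[R[i]]_n) :
  psd A -> psd X -> 0 <= \tr (A *m X).
Proof.
move=> /psd_gram[U ->] /psd_gram[W ->].
rewrite mulmxA mxtrace_mulC !mulmxA -{1}[W]trmxCK -adjmxM -mulmxA.
exact: adjmx_self_trace_ge0.
Qed.

(** Entries are inner products of the columns of a Gram factor, so [2|x||y| <= |x|^2 + |y|^2] bounds
    them by diagonal entries. Compactness arguments rest on this bound. *)
Lemma psd_entry_le (R : realType) n (A : 'M[R[i]]_n) i j :
  psd A -> `|A i j| <= \tr A.
Proof.
move=> /psd_gram[U AE].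
have AEij k l : A k l = \sum_h (U h k)^* * U h l.
  by rewrite AE mxE; apply: eq_bigr => h _; rewrite !mxE.
have dg k : A k k = \sum_h `|U h k| ^+ 2.
  by rewrite AEij; apply: eq_bigr => h _; rewrite normCKC.
have dg0 k : 0 <= A k k by rewrite dg; apply: sumr_ge0 => h _; rewrite exprn_ge0.
have dgt k : A k k <= \tr A.
  by rewrite /mxtrace (bigD1 k) //= lerDl; apply: sumr_ge0 => h _.
have two : `|A i j| *+ 2 <= A i i + A j j.
  rewrite AEij !dg -big_split /= -mulr_natl.
  apply: le_trans (_ : 2 * \sum_h `|U h i| * `|U h j| <= _).
    rewrite ler_wpM2l //; apply: le_trans (ler_norm_sum _ _ _) _.
    by apply: ler_sum => h _; rewrite normrM norm_conjC.
  rewrite mulr_sumr; apply: ler_sum => h _; rewrite -subr_ge0.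
  have -> : `|U h i| ^+ 2 + `|U h j| ^+ 2 - 2 * (`|U h i| * `|U h j|) =
    (`|U h i| - `|U h j|) ^+ 2 by ring.
  by rewrite -realEsqr rpredB ?normr_real.
have : `|A i j| *+ 2 <= \tr A *+ 2.
  by apply: le_trans two _; rewrite mulr2n lerD.
by rewrite lerMn2r.
Qed.

Lemma adjmx_self_eq0 (R : realType) n (w : 'cV[R[i]]_n) :
  (w ^t* *m w) 0 0 = 0 -> w = 0.
Proof.
rewrite mxE => /eqP; rewrite psumr_eq0; last first.
  by move=> k _; rewrite !mxE -normCKC exprn_ge0.
move=> /allP /= hk; apply/matrixP => k l; rewrite (ord1 l) [RHS]mxE.
have := hk k (mem_index_enum _).
by rewrite !mxE -normCKC sqrf_eq0 normr_eq0 => /eqP.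
Qed.

Lemma psd_qform_eq0 (R : realType) n (A : 'M[R[i]]_n) (v : 'cV[R[i]]_n) :
  psd A -> (v ^t* *m A *m v) 0 0 = 0 -> A *m v = 0.
Proof.
move=> /psd_gram[U ->]; rewrite -(mulmxA (U ^t*)) mulmxA -adjmxM -mulmxA.
by move=> /adjmx_self_eq0 ->; rewrite mulmx0.
Qed.

Lemma psdD (R : realType) n (A B : 'M[R[i]]_n) : psd A -> psd B -> psd (A + B).
Proof.
move=> /psdP pA /psdP pB; apply/psdP => v.
by rewrite mulmxDr mulmxDl mxE addr_ge0.
Qed.

Lemma psdZ (R : realType) n (a : R[i]) (A : 'M[R[i]]_n) :
  0 <= a -> psd A -> psd (a *: A).
Proof.
move=> a0 /psdP pA; apply/psdP => v.
by rewrite -scalemxAr -scalemxAl mxE mulr_ge0.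
Qed.

Lemma psd_rsc (R : realType) n (a : R) (A : 'M[R[i]]_n) :
  0 <= a -> psd A -> psd (rsc a A).
Proof. by move=> a0; apply: psdZ; rewrite ler0c. Qed.

Lemma psd_scalar (R : realType) n (a : R[i]) : 0 <= a -> psd (a%:M : 'M_n).
Proof.
move=> a0; rewrite -[a]mulr1 -scale_scalar_mx; apply: psdZ => //.
by have := psd_gramR (1%:M : 'M[R[i]]_n); rewrite mulmx1 trmx1 map_mx1.
Qed.

Lemma psd_trace_ge0 (R : realType) n (A : 'M[R[i]]_n) : psd A -> 0 <= \tr A.
Proof. by move=> /psd_gram[U ->]; exact: adjmx_self_trace_ge0. Qed.

Lemma trace_mul_bound (R : realType) n (A : 'M[R[i]]_n) :
  exists2 c : R[i], 0 <= c &
    forall X : 'M[R[i]]_n, psd X -> `|\tr (A *m X)| <= c * \tr X.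
Proof.
exists (\sum_(i < n) \sum_(j < n) `|A i j|).
  by apply: sumr_ge0 => i _; apply: sumr_ge0 => j _.
move=> X pX; rewrite mulr_suml; apply: le_trans (ler_norm_sum _ _ _) _.
apply: ler_sum => i _; rewrite mxE mulr_suml.
apply: le_trans (ler_norm_sum _ _ _) _; apply: ler_sum => j _.
by rewrite normrM ler_wpM2l // psd_entry_le.
Qed.

(** * Compactness and separation from a closed cone in finite real dimension *)

Lemma increasing_seq_cvgy (f : nat -> nat) :
  increasing_seq f -> f k @[k --> \oo] --> \oo.
Proof.
move=> fi; have fge k : (k <= f k)%N.
  elim: k => // k IH; apply: leq_ltn_trans IH _.
  by have /increasing_seqP/(_ k) := fi.
apply/cvgnyPge => A; near=> k; apply: leq_trans (fge k).
by near: k; exact: nbhs_infty_ge.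
Unshelve. all: by end_near. Qed.

Lemma cvg_finsum (R : realType) (I : finType) (u : I -> nat -> R) (l : I -> R) :
  (forall i, u i k @[k --> \oo] --> l i) ->
  \sum_i u i k @[k --> \oo] --> \sum_i l i.
Proof. by move=> ul; apply: cvg_big => // x; exact: add_continuous. Qed.

(** Subsequences are extracted one coordinate at a time along [enum T]; further extraction preserves
    the limits already obtained. *)
Lemma bolzano_weierstrass_fin (R : realType) (T : finType) (u : nat -> T -> R)
    (M : R) :
  (forall k t, `|u k t| <= M) ->
  exists (f : nat -> nat) (x : T -> R), increasing_seq f /\
    forall t, u (f k) t @[k --> \oo] --> x t.
Proof.
move=> uM.
suff [f [fi fc]] : exists f : nat -> nat, increasing_seq f /\
    forall t, t \in enum T -> cvgn (fun k => u (f k) t).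
  exists f, (fun t => limn (fun k => u (f k) t)); split=> // t.
  by apply: fc; rewrite mem_enum.
elim: (enum T) => [|t s [f [fi fc]]]; first by exists id; split.
have [] := @bolzano_weierstrass R (fun k => u (f k) t).
  by exists M; split; [exact: num_real|move=> N /ltW MN k _ /=; exact: le_trans MN].
move=> g gi gc; exists (f \o g); split=> [m k|t']; first exact: etrans (fi _ _) (gi _ _).
rewrite in_cons => /orP[/eqP -> //|/fc /cvg_ex[l /= fl]].
apply/cvg_ex; exists l; exact: cvg_comp (increasing_seq_cvgy gi) fl.
Qed.

Lemma first_order_ge0 (R : realType) (b c : R) :
  (forall s, 0 < s -> s <= 1 -> 0 <= s * b + s ^+ 2 * c) -> 0 <= b.
Proof.
move=> h; rewrite leNgt; apply/negP => b0.
have C0 : 0 < `|c| - b by rewrite subr_gt0 (lt_le_trans b0).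
(* This [s] satisfies [s |c| <= - b / 2], so [b + s c < 0] if [b < 0]. *)
pose s := - b / (2 * (`|c| - b)).
have s0 : 0 < s by rewrite divr_gt0 ?oppr_gt0 ?mulr_gt0.
have sE : s * (2 * (`|c| - b)) = - b by rewrite divfK // gt_eqF ?mulr_gt0.
have cn := normr_ge0 c; have cc := ler_norm c.
have s1 : s <= 1 by nra.
have := h s s0 s1; rewrite expr2 -mulrA -mulrDr pmulr_rge0 // leNgt => /negP; apply.
have : s * c <= s * `|c| by rewrite ler_pM2l.
by nra.
Qed.

(** The normal is [a = p - x] with [x] a point of [K] nearest to [p]. Optimality towards [x + s z]
    gives [a.z <= 0], optimality towards [(1 - s) x] gives [a.x >= 0], and then
    [a.p = |a|^2 + a.x > 0]. *)
Lemma cone_separation (R : realType) (T : finType) (K : set (T -> R))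
    (p : T -> R) :
  K (fun=> 0) ->
  (forall x y, K x -> K y -> K (fun t => x t + y t)) ->
  (forall a x, 0 <= a -> K x -> K (fun t => a * x t)) ->
  (forall (u : nat -> T -> R) x, (forall k, K (u k)) ->
     (forall t, u k t @[k --> \oo] --> x t) -> K x) ->
  ~ K p ->
  exists a : T -> R, (forall x, K x -> \sum_t a t * x t <= 0) /\
    0 < \sum_t a t * p t.
Proof.
move=> K0 KD KZ Kc Kp.
pose dist (x : T -> R) := \sum_t (x t - p t) ^+ 2.
have dist0 x : 0 <= dist x by apply: sumr_ge0 => t _; exact: sqr_ge0.
pose D := dist @` K.
have Dinf : has_inf D.
  split; first by exists (dist (fun=> 0)), (fun=> 0).
  by exists 0 => _ [x _ <-].
have /choice[u uP] k : exists x, K x /\ dist x < inf D + harmonic k.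
  have [_ [x Kx <-] xlt] := inf_adherent (harmonic_gt0 k) Dinf.
  by exists x.
have inf0 : 0 <= inf D by apply: lb_le_inf => [|_ [x _ <-]//]; case: Dinf.
have h1 k : harmonic k <= 1 :> R.
  by rewrite /harmonic /= invf_le1 ?ltr0n // ler1n.
(* A minimizing sequence stays in a ball around [p]: [r^2 <= d + 1] with [d >= 0] forces
   [r <= d + 2]. *)
have uM k t : `|u k t| <= \sum_t `|p t| + (inf D + 2).
  have [_ /ltW ud] := uP k.
  have e1 : (u k t - p t) ^+ 2 <= inf D + 1.
    apply: le_trans (_ : dist (u k) <= _); last by have := h1 k; lra.
    rewrite /dist (bigD1 t) //= lerDl; apply: sumr_ge0 => j _; exact: sqr_ge0.
  have e2 : `|u k t - p t| <= inf D + 2.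
    have := normr_ge0 (u k t - p t); move: e1; rewrite -real_normK ?num_real //.
    by move: `|_ - _| inf0 => r; nra.
  have e3 : `|p t| <= \sum_t `|p t|.
    by rewrite (bigD1 t) //= lerDl; apply: sumr_ge0.
  by have := ler_normD (u k t - p t) (p t); rewrite subrK; lra.
have [f [x [fi fx]]] := bolzano_weierstrass_fin uM.
have Kx : K x by apply: (Kc (fun k => u (f k))) => // k; have [] := uP (f k).
have xmin z : K z -> dist x <= dist z.
  move=> Kz; apply: (@le_trans _ _ (inf D)); last first.
    by apply: ge_inf; [case: Dinf|exists z].
  (* Subtracting the slack [harmonic (f k)] puts the sequence below [inf D], so its limit [dist x]
     is below too. *)
  have cv : dist (u (f k)) - harmonic (f k) @[k --> \oo] --> dist x - 0.
    apply: cvgB; last exact: cvg_comp (increasing_seq_cvgy fi) (@cvg_harmonic R).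
    apply: cvg_finsum => t; rewrite expr2.
    by apply: cvgM; apply: cvgB (fx t) (cvg_cst _).
  rewrite -[dist x]subr0; apply: cvgr_to_le cv _; near=> k.
  by have [_ /ltW] := uP (f k); rewrite lerBlDr.
pose a t := p t - x t.
have aK z : K z -> \sum_t a t * z t <= 0.
  move=> Kz; rewrite -oppr_ge0.
  suff : 0 <= 2 * - (\sum_t a t * z t) by lra.
  apply: (@first_order_ge0 _ _ (\sum_t z t ^+ 2)) => s s0 _.
  have /xmin := KD _ _ Kx (KZ _ _ (ltW s0) Kz).
  rewrite -subr_ge0 /dist -sumrB.
  congr (_ <= _); rewrite mulrN mulrN !mulr_sumr -sumrN -big_split /=.
  by apply: eq_bigr => t _; rewrite /a; ring.
have ax : 0 <= \sum_t a t * x t.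
  suff : 0 <= 2 * (\sum_t a t * x t) by lra.
  apply: (@first_order_ge0 _ _ (\sum_t x t ^+ 2)) => s s0 s1.
  (* The cone admits only nonnegative factors, which is where [s <= 1] is used. *)
  have /xmin : K (fun t => (1 - s) * x t) by apply: KZ => //; lra.
  rewrite -subr_ge0 /dist -sumrB.
  congr (_ <= _); rewrite !mulr_sumr -big_split /=.
  by apply: eq_bigr => t _; rewrite /a; ring.
exists a; split=> //.
have -> : \sum_t a t * p t = \sum_t a t ^+ 2 + \sum_t a t * x t.
  by rewrite -big_split /=; apply: eq_bigr => t _; rewrite /a; ring.
rewrite ltr_wpDr // lt_def; apply/andP; split; last first.
  by apply: sumr_ge0 => t _; exact: sqr_ge0.
apply/negP; rewrite psumr_eq0 => [/allP a0|t _]; last exact: sqr_ge0.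
apply: Kp; suff -> : p = x by [].
apply/funext => t; have := a0 t (mem_index_enum _).
by rewrite /= sqrf_eq0 subr_eq0 => /eqP.
Unshelve. all: by end_near. Qed.

(** * Limits of complex sequences and of operators *)

Definition ccvg (R : realType) (z : nat -> R[i]) (l : R[i]) : Prop :=
  ((fun k => complex.Re (z k)) : R^nat) @ \oo --> (complex.Re l : R) /\
  ((fun k => complex.Im (z k)) : R^nat) @ \oo --> (complex.Im l : R).

Lemma ReD (R : realType) (x y : R[i]) :
  complex.Re (x + y) = complex.Re x + complex.Re y.
Proof. by case: x; case: y. Qed.

Lemma ImD (R : realType) (x y : R[i]) :
  complex.Im (x + y) = complex.Im x + complex.Im y.
Proof. by case: x; case: y. Qed.

Lemma ReM (R : realType) (x y : R[i]) : complex.Re (x * y) =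
  complex.Re x * complex.Re y - complex.Im x * complex.Im y.
Proof. by case: x; case: y. Qed.

Lemma ImM (R : realType) (x y : R[i]) : complex.Im (x * y) =
  complex.Re x * complex.Im y + complex.Im x * complex.Re y.
Proof. by case: x => a b; case: y => c d /=; ring. Qed.

Lemma ccvg_cst (R : realType) (c : R[i]) : ccvg (fun=> c) c.
Proof. by split; exact: cvg_cst. Qed.

Lemma ccvgD (R : realType) (x y : nat -> R[i]) a b :
  ccvg x a -> ccvg y b -> ccvg (fun k => x k + y k) (a + b).
Proof.
move=> [xr xi] [yr yi]; split; rewrite ?ReD ?ImD.
- by under eq_fun do rewrite ReD; apply: cvgD.
- by under eq_fun do rewrite ImD; apply: cvgD.
Qed.

Lemma ccvgM (R : realType) (x y : nat -> R[i]) a b :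
  ccvg x a -> ccvg y b -> ccvg (fun k => x k * y k) (a * b).
Proof.
move=> [xr xi] [yr yi]; split; rewrite ?ReM ?ImM.
- by under eq_fun do rewrite ReM; apply: cvgB; apply: cvgM.
- by under eq_fun do rewrite ImM; apply: cvgD; apply: cvgM.
Qed.

Lemma ccvg_sum (R : realType) (I : finType) (x : I -> nat -> R[i]) a :
  (forall i, ccvg (x i) (a i)) -> ccvg (fun k => \sum_i x i k) (\sum_i a i).
Proof.
move=> xa; elim: (index_enum I) => [|i s IH].
  by under eq_fun do rewrite big_nil; rewrite big_nil; exact: ccvg_cst.
under eq_fun do rewrite big_cons; rewrite big_cons; exact: ccvgD.
Qed.

Lemma ccvg_unique (R : realType) (z : nat -> R[i]) a b :
  ccvg z a -> ccvg z b -> a = b.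
Proof.
move=> [ar ai] [br bi]; apply/eqP; rewrite eq_complex.
rewrite (cvg_unique (@Rhausdorff R) ar br).
by rewrite (cvg_unique (@Rhausdorff R) ai bi) !eqxx.
Qed.

Lemma ccvg_ge0 (R : realType) (z : nat -> R[i]) a :
  ccvg z a -> (forall k, 0 <= z k) -> 0 <= a.
Proof.
move=> [ar ai] z0; rewrite lecE; apply/andP; split; last first.
  by apply: cvgr_to_ge ar _; near=> k; have := z0 k; rewrite lecE => /andP[].
apply/eqP/(cvg_unique (@Rhausdorff R) ai).
have -> : (fun k => complex.Im (z k)) = fun=> 0; last exact: cvg_cst.
by apply/funext => k; have := z0 k; rewrite lecE => /andP[/eqP].
Unshelve. all: by end_near. Qed.

Lemma ccvg_subseq (R : realType) (z : nat -> R[i]) a (f : nat -> nat) :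
  increasing_seq f -> ccvg z a -> ccvg (fun k => z (f k)) a.
Proof.
by move=> fi [ar ai]; split; [move: ar|move: ai];
  exact: cvg_comp (increasing_seq_cvgy fi).
Qed.

Lemma op_cvgP (R : realType) n (u : nat -> 'M[R[i]]_n) X :
  op_cvg u X <-> forall i j, ccvg (fun k => u k i j) (X i j).
Proof. by []. Qed.

Lemma op_cvgD (R : realType) n (u v : nat -> 'M[R[i]]_n) X Y :
  op_cvg u X -> op_cvg v Y -> op_cvg (fun k => u k + v k) (X + Y).
Proof.
move=> uX vY; apply/op_cvgP => i j; rewrite mxE.
by under eq_fun do rewrite mxE; exact: ccvgD.
Qed.

Lemma op_cvgZ (R : realType) n (a : R[i]) (u : nat -> 'M[R[i]]_n) X :
  op_cvg u X -> op_cvg (fun k => a *: u k) (a *: X).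
Proof.
move=> uX; apply/op_cvgP => i j; rewrite mxE.
by under eq_fun do rewrite mxE; apply: ccvgM => //; exact: ccvg_cst.
Qed.

Lemma op_cvg_subseq (R : realType) n (u : nat -> 'M[R[i]]_n) X (f : nat -> nat) :
  increasing_seq f -> op_cvg u X -> op_cvg (fun k => u (f k)) X.
Proof. by move=> fi uX; apply/op_cvgP => i j; exact: ccvg_subseq (uX i j). Qed.

Lemma op_cvg_trace (R : realType) n (u : nat -> 'M[R[i]]_n) X :
  op_cvg u X -> ccvg (fun k => \tr (u k)) (\tr X).
Proof. by move=> uX; apply: ccvg_sum => i; exact: uX. Qed.

(** Each entry of [g A] is a finite combination of the entries of [A], with fixed coefficients
    [g (delta_mx i j) k l]. *)
Lemma op_cvg_linear (R : realType) n (g : {linear 'M[R[i]]_n -> 'M[R[i]]_n})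
    (u : nat -> 'M[R[i]]_n) X :
  op_cvg u X -> op_cvg (fun k => g (u k)) (g X).
Proof.
move=> uX; apply/op_cvgP => k l.
have gE (A : 'M[R[i]]_n) :
    g A k l = \sum_i \sum_j A i j * g (delta_mx i j) k l.
  rewrite {1}[A]matrix_sum_delta raddf_sum summxE; apply: eq_bigr => i _.
  by rewrite raddf_sum summxE; apply: eq_bigr => j _; rewrite /= linearZ mxE.
rewrite gE; under eq_fun do rewrite gE.
by do 2![apply: ccvg_sum => ?]; apply: ccvgM; [exact: uX|exact: ccvg_cst].
Qed.

Lemma psd_closed (R : realType) n (u : nat -> 'M[R[i]]_n) X :
  op_cvg u X -> (forall k, psd (u k)) -> psd X.
Proof.
move=> uX pu v.
apply: (@ccvg_ge0 _ (fun k => \sum_i \sum_j (v i)^* * u k i j * v j)); last first.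
  by move=> k; exact: pu.
do 2![apply: ccvg_sum => ?]; apply: ccvgM; last exact: ccvg_cst.
by apply: ccvgM; [exact: ccvg_cst|exact: uX].
Qed.

(** [L] is the fixed-point set of [projv L], which is linear and so preserves limits. *)
Lemma vspace_closed (R : realType) n (L : {vspace 'M[R[i]]_n})
    (u : nat -> 'M[R[i]]_n) X :
  op_cvg u X -> (forall k, u k \in L) -> X \in L.
Proof.
move=> uX uL; suff <- : projv L X = X by exact: memv_proj.
have pX := op_cvg_linear (projv L) uX.
apply/matrixP => i j; apply: ccvg_unique (pX i j) _.
have -> : (fun k => projv L (u k) i j) = fun k => u k i j; last exact: uX.
by apply/funext => k; rewrite projv_id.
Qed.

(** * The linear span of the free states *)

Lemma trace_rsc (R : realType) n (a : R) (A : 'M[R[i]]_n) :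
  \tr (rsc a A) = (a%:C)%C * \tr A.
Proof. exact: linearZ. Qed.

(* Only the real parts of the coefficients matter for a Hermitian element of
   the complex span, so the affine hypothesis applies to it. *)
Lemma free_span (R : realType) n (F : set 'M[R[i]]_n) :
  affine_free_set F -> exists L : {vspace 'M[R[i]]_n},
    (forall s, F s -> s \in L) /\
    forall Y, Y \in L -> psd Y -> 0 < \tr Y -> F ((\tr Y)^-1 *: Y).
Proof.
move=> [_ [_ [_ [Fd Faff]]]].
(* [L] is spanned by a finite list of free states of largest possible dimension; adjoining another
   free state cannot enlarge the span, so [L] contains all of [F]. *)
pose P k := `[< exists2 s : seq 'M[R[i]]_n,
                  (forall x, x \in s -> F x) & \dim <<s>>%VS = k >].
have exP : exists k, P k.
  by exists (\dim <<([::] : seq 'M[R[i]]_n)>>%VS); apply/asboolP; exists [::].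
have ubP k : P k -> (k <= \dim {: 'M[R[i]]_n})%N.
  by move=> /asboolP[s _ <-]; exact/dimvS/subvf.
case: (ex_maxnP exP ubP) => d /asboolP[s sF sd] dmax.
exists <<s>>%VS; split=> [x Fx|Y YL pY trY].
  have : (\dim <<x :: s>>%VS <= d)%N.
    apply: dmax; apply/asboolP; exists (x :: s) => // y.
    by rewrite in_cons => /orP[/eqP -> //|/sF].
  move=> dx; have : (<<s>> == <<x :: s>>)%VS.
    by rewrite eqEdim sd dx andbT; apply: sub_span => y ys; rewrite in_cons ys orbT.
  by move=> /eqP ->; apply: memv_span; rewrite mem_head.
have := coord_span (X := in_tuple s) YL.
set c := (fun i => coord (in_tuple s) i Y) => YE.
have sFi (i : 'I_(size s)) : F s`_i by apply: sF; rewrite mem_nth.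
have YR : Y = \sum_i rsc (complex.Re (c i)) s`_i.
  have -> : Y = 2^-1 *: (Y + Y ^t*).
    by rewrite psd_herm // -mulr2n -[Y *+ 2]scaler_nat scalerA mulVf ?scale1r ?pnatr_eq0.
  rewrite {2}YE (raddf_sum (@trmx _ n n)) /=.
  have -> (Z : 'I_(size s) -> 'M[R[i]]_n) :
      map_mx Num.conj (\sum_i Z i) = \sum_i map_mx Num.conj (Z i).
    exact: raddf_sum.
  rewrite {1}YE -big_split /= scaler_sumr; apply: eq_bigr => i _.
  rewrite adjmxZ psd_herm; last by have [] := Fd _ (sFi i).
  by rewrite -scalerDl scalerA /rsc ReJ_add mulrC.
have trE : \tr Y = ((\sum_i complex.Re (c i))%:C)%C.
  rewrite {1}YR raddf_sum /= rmorph_sum /=; apply: eq_bigr => i _.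
  by rewrite trace_rsc; have [_ ->] := Fd _ (sFi i); rewrite mulr1.
set t := \sum_i _ in trE.
have t0 : 0 < t by move: trY; rewrite trE ltcR.
apply/Faff; split; last first.
  split; first by apply: psdZ => //; rewrite invr_ge0 ltW.
  by rewrite linearZ /= mulVf // gt_eqF.
exists (size s), (fun i => t^-1 * complex.Re (c i)), (fun i => s`_i); split=> //.
split; first by rewrite -mulr_sumr mulVf // gt_eqF.
rewrite trE {1}YR scaler_sumr; apply: eq_bigr => i _.
by rewrite /rsc scalerA rmorphM fmorphV.
Qed.

(** * Real coordinates on pairs of operators, and conic duality *)

(** The first boolean selects the operator of the pair, the second its real or imaginary part. Pairs
    thus become points of a finite real space, where [cone_separation] applies. *)
Definition opcoord (R : realType) n (X Y : 'M[R[i]]_n)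
    (t : bool * bool * ('I_n * 'I_n)) : R :=
  let z := (if t.1.1 then X else Y) t.2.1 t.2.2 in
  if t.1.2 then complex.Re z else complex.Im z.

Definition opcoord_inv (R : realType) n (x : bool * bool * ('I_n * 'I_n) -> R)
    (b : bool) : 'M[R[i]]_n :=
  \matrix_(i, j) Complex (x (b, true, (i, j))) (x (b, false, (i, j))).

Lemma opcoordK (R : realType) n (x : bool * bool * ('I_n * 'I_n) -> R) :
  opcoord (opcoord_inv x true) (opcoord_inv x false) = x.
Proof.
by apply/funext => -[[b1 b2] [i j]]; case: b1; case: b2; rewrite /opcoord /= mxE.
Qed.

Lemma opcoord_cvg (R : realType) n (X Y : nat -> 'M[R[i]]_n)
    (x : bool * bool * ('I_n * 'I_n) -> R) :
  (forall t, opcoord (X k) (Y k) t @[k --> \oo] --> x t) ->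
  op_cvg X (opcoord_inv x true) /\ op_cvg Y (opcoord_inv x false).
Proof.
move=> h; split; apply/op_cvgP => i j; rewrite mxE.
  by split; [exact: (h (true, true, (i, j)))|exact: (h (true, false, (i, j)))].
by split; [exact: (h (false, true, (i, j)))|exact: (h (false, false, (i, j)))].
Qed.

Definition rip (R : realType) n (A X : 'M[R[i]]_n) : R :=
  \sum_i \sum_j (complex.Re (A i j) * complex.Re (X i j) +
                 complex.Im (A i j) * complex.Im (X i j)).

Lemma opcoord_dot (R : realType) n (a : bool * bool * ('I_n * 'I_n) -> R)
    (X Y : 'M[R[i]]_n) :
  \sum_t a t * opcoord X Y t =
  rip (opcoord_inv a true) X + rip (opcoord_inv a false) Y.
Proof.
transitivity (\sum_(b : bool * bool) \sum_(q : 'I_n * 'I_n)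
    a (b, q) * opcoord X Y (b, q)).
  by rewrite pair_bigA; apply: eq_bigr => -[].
transitivity (\sum_(b : bool) \sum_(c : bool) \sum_(q : 'I_n * 'I_n)
    a (b, c, q) * opcoord X Y (b, c, q)).
  by rewrite [RHS]pair_bigA; apply: eq_bigr => -[].
rewrite !big_bool /= /rip !pair_bigA /= -!big_split /=.
by apply: eq_bigr => -[i j] _; rewrite !mxE /opcoord /=.
Qed.

Lemma Re_sum (R : realType) (I : finType) (z : I -> R[i]) :
  complex.Re (\sum_i z i) = \sum_i complex.Re (z i).
Proof.
by elim/big_rec2: _ => // i x y _ <-; rewrite ReD.
Qed.

Lemma ripE (R : realType) n (A X : 'M[R[i]]_n) :
  rip A X = complex.Re (\tr (A ^t* *m X)).
Proof.
rewrite Re_sum /rip exchange_big; apply: eq_bigr => j _.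
rewrite mxE Re_sum; apply: eq_bigr => i _; rewrite !mxE ReM.
by case: (A i j) => a b /=; rewrite mulNr opprK.
Qed.

Lemma ripN (R : realType) n (A X : 'M[R[i]]_n) : rip A (- X) = - rip A X.
Proof.
by rewrite !ripE mulmxN raddfN /=; case: (\tr _).
Qed.

Lemma trace_adjmx (R : realType) n (A : 'M[R[i]]_n) : \tr (A ^t*) = (\tr A)^*.
Proof. by rewrite rmorph_sum; apply: eq_bigr => i _; rewrite !mxE. Qed.

(** A separating functional need not come from a Hermitian matrix, but on Hermitian arguments only
    its Hermitian part acts. *)
Definition hermpart (R : realType) n (A : 'M[R[i]]_n) : 'M[R[i]]_n :=
  2^-1 *: (A + A ^t*).

Lemma trace_hermpart (R : realType) n (A X : 'M[R[i]]_n) :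
  X ^t* = X -> \tr (hermpart A *m X) = ((rip A X)%:C)%C.
Proof.
move=> hX; rewrite ripE ReJ_add /hermpart -scalemxAl linearZ /= mulmxDl.
rewrite raddfD /= mulrC; congr (_ / _); rewrite addrC; congr (_ + _).
transitivity (\tr ((A ^t* *m X) ^t*)); last by rewrite trace_adjmx.
by rewrite adjmxM trmxCK hX mxtrace_mulC.
Qed.

(** Self-duality of the psd cone: the rank-one operators [v v^*] are enough tests. *)
Lemma psd_dual (R : realType) n (A : 'M[R[i]]_n) :
  (forall P, psd P -> 0 <= \tr (A *m P)) -> psd A.
Proof.
move=> h; apply/psdP => v; rewrite -trace_mx11 mxtrace_mulC mulmxA mxtrace_mulC.
by apply: h; have := psd_gramR (v ^t*); rewrite trmxCK.
Qed.

Lemma normIm_le (R : realType) (z : R[i]) : (`|complex.Im z|%:C)%C <= `|z|.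
Proof.
by case: z => a b; rewrite normc_def lecR /= -sqrtr_sqr ler_wsqrtr // lerDr sqr_ge0.
Qed.

Lemma psd0 (R : realType) n : psd (0 : 'M[R[i]]_n).
Proof. by apply/psdP => v; rewrite mulmx0 mul0mx mxE. Qed.

Lemma opcoordD (R : realType) n (X Y X' Y' : 'M[R[i]]_n) :
  (fun t => opcoord X Y t + opcoord X' Y' t) = opcoord (X + X') (Y + Y').
Proof.
apply/funext => -[[b1 b2] [i j]].
by case: b1; case: b2; rewrite /opcoord /= mxE ?ReD ?ImD.
Qed.

Lemma opcoordZ (R : realType) n (a : R) (X Y : 'M[R[i]]_n) :
  (fun t => a * opcoord X Y t) = opcoord (rsc a X) (rsc a Y).
Proof.
apply/funext => -[[b1 b2] [i j]].
by case: b1; case: b2; rewrite /opcoord /rsc /= mxE ?ReM ?ImM /=;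
  rewrite mul0r ?subr0 ?addr0.
Qed.

Lemma opcoord_psd_bound (R : realType) n (P Q : 'M[R[i]]_n) t :
  psd P -> psd Q -> `|opcoord P Q t| <= complex.Re (\tr (P + Q)).
Proof.
move=> pP pQ; rewrite -lecR.
have -> : ((complex.Re (\tr (P + Q)))%:C)%C = \tr (P + Q).
  by apply: RRe_real; rewrite ger0_real // psd_trace_ge0 //; exact: psdD.
rewrite raddfD /=.
have tP := psd_trace_ge0 pP; have tQ := psd_trace_ge0 pQ.
case: t => -[b1 b2] [i j]; rewrite /opcoord /=.
have : `|(if b1 then P else Q) i j| <= \tr P + \tr Q.
  case: b1; first by apply: le_trans (psd_entry_le i j pP) _; rewrite lerDl.
  by apply: le_trans (psd_entry_le i j pQ) _; rewrite lerDr.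
by apply: le_trans; case: b2; [exact: normc_ge_Re|exact: normIm_le].
Qed.

(* The cone {(Y - P, - Y - Q) | Y in L, P, Q psd} is closed because P + Q is
   controlled by the sum of the two components, so P and Q stay bounded along a
   convergent sequence. *)
Lemma sandwich_cone_closed (R : realType) n (L : {vspace 'M[R[i]]_n})
    (u : nat -> bool * bool * ('I_n * 'I_n) -> R) x :
  let K := [set x | exists Y P Q, [/\ Y \in L, psd P, psd Q &
                      x = opcoord (Y - P) (- Y - Q)]] in
  (forall k, K (u k)) -> (forall t, u k t @[k --> \oo] --> x t) -> K x.
Proof.
move=> K uK ux.
have /choice[Z ZP] k : exists Z : 'M[R[i]]_n * ('M[R[i]]_n * 'M[R[i]]_n),
    [/\ Z.1 \in L, psd Z.2.1, psd Z.2.2 &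
        u k = opcoord (Z.1 - Z.2.1) (- Z.1 - Z.2.2)].
  by have [Y [P [Q ?]]] := uK k; exists (Y, (P, Q)).
pose Y k := (Z k).1; pose P k := (Z k).2.1; pose Q k := (Z k).2.2.
have YL k : Y k \in L by have [] := ZP k.
have pP k : psd (P k) by have [] := ZP k.
have pQ k : psd (Q k) by have [] := ZP k.
have uE k : u k = opcoord (Y k - P k) (- Y k - Q k) by have [] := ZP k.
have [cD cE] : op_cvg (fun k => Y k - P k) (opcoord_inv x true) /\
               op_cvg (fun k => - Y k - Q k) (opcoord_inv x false).
  by apply: opcoord_cvg => t; under eq_fun do rewrite -uE; exact: ux.
set D := opcoord_inv x true in cD; set E := opcoord_inv x false in cE.
have [M PQM] : exists M : R, forall k, complex.Re (\tr (P k + Q k)) <= M.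
  have [cT _] := op_cvg_trace (op_cvgZ (-1) (op_cvgD cD cE)).
  have /cvg_seq_bounded[M [_ hM]] :
    cvgn (fun k => complex.Re (\tr (-1 *: (Y k - P k + (- Y k - Q k))))).
    by apply/cvg_ex; eexists; exact: cT.
  have M1 : M < M + 1 by rewrite ltrDl.
  exists (M + 1) => k; have := hM (M + 1) M1 k I => /=.
  have -> : -1 *: (Y k - P k + (- Y k - Q k)) = P k + Q k.
    by rewrite scaleN1r addrACA subrr add0r opprD !opprK.
  by apply: le_trans; exact: ler_norm.
have PQb k t : `|opcoord (P k) (Q k) t| <= M.
  by apply: le_trans (PQM k); exact: opcoord_psd_bound.
have [f [w [fi fw]]] := bolzano_weierstrass_fin PQb.
have [cP cQ] := opcoord_cvg fw.
set Pl := opcoord_inv w true in cP; set Ql := opcoord_inv w false in cQ.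
have pPl : psd Pl by apply: psd_closed cP _ => k; exact: pP.
have pQl : psd Ql by apply: psd_closed cQ _ => k; exact: pQ.
(* [Y] is recovered as [(Y - P) + P], a sum of convergent sequences; [Q] then follows from the
   second component. *)
have cY : op_cvg (fun k => Y (f k)) (D + Pl).
  have := op_cvgD (op_cvg_subseq fi cD) cP.
  by under eq_fun do rewrite subrK.
have cQ' : op_cvg (fun k => Q (f k)) (-1 *: (E + (D + Pl))).
  have := op_cvgZ (-1) (op_cvgD (op_cvg_subseq fi cE) cY).
  have -> // : (fun k => -1 *: (- Y (f k) - Q (f k) + Y (f k))) = Q \o f.
  by apply/funext => k; rewrite addrAC addNr add0r scaleN1r opprK.
have QE : Ql = -1 *: (E + (D + Pl)).
  by apply/matrixP => i j; exact: ccvg_unique (cQ i j) (cQ' i j).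
exists (D + Pl), Pl, Ql; split=> //.
  by apply: vspace_closed cY _ => k; exact: YL.
by rewrite addrK QE scaleN1r opprK addrCA addNr addr0 opcoordK.
Qed.

(** A Farkas alternative: the pair [(A0, - B0)] lies in the closed cone exactly when some [Y] in [L]
    is sandwiched. Otherwise a separating functional [(A, B)] exists; testing it on [P] and [Q]
    gives positivity, testing it on [L] gives agreement. *)
Lemma sandwich_duality (R : realType) n (L : {vspace 'M[R[i]]_n})
    (A0 B0 : 'M[R[i]]_n) :
  A0 ^t* = A0 -> B0 ^t* = B0 ->
  ~ (exists Y, [/\ Y \in L, loewner A0 Y & loewner Y B0]) ->
  exists A B : 'M[R[i]]_n, [/\ psd A, psd B,
    forall Y, Y \in L -> Y ^t* = Y -> \tr (A *m Y) = \tr (B *m Y) &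
    \tr (B *m B0) < \tr (A *m A0)].
Proof.
move=> hA0 hB0 noY.
pose K := [set x | exists Y P Q, [/\ Y \in L, psd P, psd Q &
                      x = @opcoord R n (Y - P) (- Y - Q)]].
have [||||| a [aK ap]] := @cone_separation R _ K (opcoord A0 (- B0)).
- exists 0, 0, 0; split; rewrite ?mem0v //; try exact: psd0.
  apply/funext => -[[b1 b2] [i j]].
  by rewrite /opcoord oppr0 addr0; case: b1; case: b2; rewrite mxE.
- move=> _ _ [Y [P [Q [YL pP pQ ->]]]] [Y' [P' [Q' [YL' pP' pQ' ->]]]].
  exists (Y + Y'), (P + P'), (Q + Q'); split; rewrite ?memvD //; try exact: psdD.
  by rewrite opcoordD !opprD; congr opcoord; rewrite addrACA.
- move=> c _ c0 [Y [P [Q [YL pP pQ ->]]]].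
  exists (rsc c Y), (rsc c P), (rsc c Q); split; rewrite ?memvZ //;
    try exact: psd_rsc.
  by rewrite opcoordZ /rsc !scalerBr scalerN.
- exact: sandwich_cone_closed.
- move=> [Y [P [Q [YL pP pQ e]]]]; apply: noY.
  have eq t := congr1 (fun g => g t) e.
  have [e1 e2] : A0 = Y - P /\ - B0 = - Y - Q.
    split; apply/matrixP => i j; apply/eqP; rewrite eq_complex; apply/andP; split.
    + by apply/eqP; exact: (eq (true, true, (i, j))).
    + by apply/eqP; exact: (eq (true, false, (i, j))).
    + by apply/eqP; exact: (eq (false, true, (i, j))).
    + by apply/eqP; exact: (eq (false, false, (i, j))).
  exists Y; split=> //; rewrite /loewner.
    by rewrite e1 opprB addrCA subrr addr0.
  by rewrite -[B0]opprK e2 opprD !opprK addrAC subrr add0r.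
pose A := opcoord_inv a true; pose B := opcoord_inv a false.
have ABK Y P Q : Y \in L -> psd P -> psd Q -> rip A (Y - P) + rip B (- Y - Q) <= 0.
  by move=> YL pP pQ; rewrite -opcoord_dot; apply: aK; exists Y, P, Q.
have rip0 (X : 'M[R[i]]_n) : rip X 0 = 0.
  by rewrite ripE mulmx0 raddf0.
exists (hermpart A), (hermpart B); split.
- apply: psd_dual => P pP; rewrite trace_hermpart; last exact: psd_herm.
  have := ABK 0 P 0 (mem0v _) pP (@psd0 R n).
  by rewrite sub0r subr0 oppr0 rip0 addr0 ripN oppr_le0 ler0c.
- apply: psd_dual => Q pQ; rewrite trace_hermpart; last exact: psd_herm.
  have := ABK 0 0 Q (mem0v _) (@psd0 R n) pQ.
  by rewrite subr0 oppr0 rip0 !add0r ripN oppr_le0 ler0c.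
(* Both [Y] and [- Y] lie in [L], so the separating inequality becomes an equality. *)
- move=> Y YL hY; rewrite !trace_hermpart //; congr (_%:C)%C.
  have := ABK Y 0 0 YL (@psd0 R n) (@psd0 R n).
  have := ABK (- Y) 0 0 _ (@psd0 R n) (@psd0 R n); rewrite memvN => /(_ YL).
  by rewrite !subr0 !ripN; lra.
- rewrite !trace_hermpart // ltcR; have := ap; rewrite opcoord_dot ripN.
  by rewrite subr_gt0.
Qed.

(** * Primal witnesses and dual certificates for Omega *)

Lemma ge0_Re (R : realType) (z : R[i]) : 0 <= z -> z = ((complex.Re z)%:C)%C.
Proof. by move=> /ger0_real /RRe_real ->. Qed.

Lemma loewner_density_ge1 (R : realType) n (X Y : 'M[R[i]]_n) (l : R) :
  density X -> density Y -> loewner X (rsc l Y) -> 1 <= l.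
Proof.
move=> [_ X1] [_ Y1] /psd_trace_ge0; rewrite raddfB /= trace_rsc X1 Y1 mulr1.
by rewrite subr_ge0 -[1](rmorph1 (real_complex R)) lecR.
Qed.

Lemma Rmax_ge1 (R : realType) n (X Y : 'M[R[i]]_n) :
  density X -> density Y -> (1%:E <= Rmax X Y)%E.
Proof.
move=> dX dY; apply: le_ereal_inf_tmp => _ [l Xl <-].
by rewrite lee_fin; exact: loewner_density_ge1 Xl.
Qed.

(** Both factors are at least 1, so an infinite one would make the product infinite. With both
    finite, [l] is chosen first within the slack, then [m] within what is left. *)
Lemma Omega_lt_witness (R : realType) n (F : set 'M[R[i]]_n) rho (c : R) :
  (forall X, F X -> density X) -> density rho -> (OmegaF F rho < c%:E)%E ->
  exists s (l m : R), [/\ F s, loewner rho (rsc l s), loewner s (rsc m rho),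
    1 <= l /\ 1 <= m & l * m < c].
Proof.
move=> Fd drho /ereal_inf_lt[_ [s Fs <-]].
have ds := Fd _ Fs.
have x1 := Rmax_ge1 drho ds; have y1 := Rmax_ge1 ds drho.
case ex : (Rmax rho s) x1 => [x| |] // x1; last first.
  by rewrite gt0_mulye ?ltNge ?leey // -ltNge (lt_le_trans _ y1) ?lte_fin.
case ey : (Rmax s rho) y1 => [y| |] // y1; last first.
  by rewrite gt0_muley ?ltNge ?leey // -ltNge (lt_le_trans _ x1) ?lte_fin.
rewrite -EFinM lte_fin => xyc; rewrite !lee_fin in x1 y1.
have y0 : 0 < y by apply: lt_le_trans y1.
have : (Rmax rho s < (c / y)%:E)%E by rewrite ex lte_fin ltr_pdivlMr.
move=> /ereal_inf_lt[_ [l sl <-]]; rewrite lte_fin ltr_pdivlMr // => lyc.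
have l1 := loewner_density_ge1 drho ds sl.
have l0 : 0 < l by apply: lt_le_trans l1.
have : (Rmax s rho < (c / l)%:E)%E by rewrite ey lte_fin ltr_pdivlMr // mulrC.
move=> /ereal_inf_lt[_ [m sm <-]]; rewrite lte_fin ltr_pdivlMr // => mlc.
have m1 := loewner_density_ge1 ds drho sm.
by exists s, l, m; split=> //; rewrite mulrC.
Qed.

Lemma Omega_le (R : realType) n (F : set 'M[R[i]]_n) rho s (l m : R) :
  (forall X, F X -> density X) -> density rho -> F s ->
  loewner rho (rsc l s) -> loewner s (rsc m rho) -> (OmegaF F rho <= (l * m)%:E)%E.
Proof.
move=> Fd drho Fs sl sm; have ds := Fd _ Fs.
apply: (@le_trans _ _ (Rmax rho s * Rmax s rho)%E).
  by apply: ereal_inf_lbound; exists s.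
rewrite EFinM; apply: lee_pmul.
- by apply: le_trans (Rmax_ge1 drho ds); rewrite lee_fin.
- by apply: le_trans (Rmax_ge1 ds drho); rewrite lee_fin.
- by apply: ereal_inf_lbound; exists l.
- by apply: ereal_inf_lbound; exists m.
Qed.

(* Shifting both operators by a small multiple of the identity makes the
   denominator b positive. *)
Lemma Omega_dual (R : realType) n (F : set 'M[R[i]]_n) rho (w : R) :
  affine_free_set F -> density rho -> 1 <= w -> (w%:E < OmegaF F rho)%E ->
  exists (A B : 'M[R[i]]_n) (a b : R), [/\ psd A, psd B,
    forall s, F s -> \tr (A *m s) = \tr (B *m s),
    \tr (A *m rho) = (a%:C)%C /\ \tr (B *m rho) = (b%:C)%C & 0 < b /\ w * b < a].
Proof.
move=> aF drho w1 wO; have [prho rho1] := drho.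
have [_ [_ [_ [Fd _]]]] := aF.
have w0 : 0 < w by apply: lt_le_trans w1.
have [L [FL LF]] := free_span aF.
have [|||A [B [pA pB AB lt]]] := @sandwich_duality R n L rho (rsc w rho).
- exact: psd_herm.
- by apply: psd_herm; apply: psd_rsc (ltW w0) prho.
(* A sandwiched [Y] of trace [t] normalizes to a free state with constants [t] and [w / t], which
   would give Omega at most [w]. *)
- move=> [Y [YL rY Yr]]; have pY : psd Y.
    by rewrite -[Y](subrK rho); exact: psdD.
  have tY1 : 1 <= \tr Y.
    by have := psd_trace_ge0 rY; rewrite raddfB /= rho1 subr_ge0.
  have tY0 : 0 < \tr Y by apply: lt_le_trans tY1.
  have Fs := LF Y YL pY tY0.
  have tYE := ge0_Re (ltW tY0); set t := complex.Re _ in tYE.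
  have t0 : 0 < t by rewrite -ltcR -tYE.
  suff : (OmegaF F rho <= (t * (w / t))%:E)%E.
    by rewrite mulrCA divff ?gt_eqF // mulr1 leNgt wO.
  apply: (Omega_le Fd drho Fs).
    by rewrite /rsc -tYE scalerA divff ?scale1r // gt_eqF.
  rewrite /loewner /rsc rmorphM /= fmorphV /= -tYE mulrC -scalerA -scalerBr.
  by apply: psdZ => //; rewrite invr_ge0 ltW.
have aE := ge0_Re (psd_trace_mul pA prho); have bE := ge0_Re (psd_trace_mul pB prho).
set a := complex.Re _ in aE; set b := complex.Re _ in bE.
have b0 : 0 <= b by rewrite -ler0c -bE; exact: psd_trace_mul.
have wba : w * b < a.
  by move: lt; rewrite /rsc -scalemxAr linearZ /= aE bE -rmorphM ltcR.
(* Keeping [w (b + d) < a + d] requires [(w - 1) d < a - w b], which this [d] satisfies. The same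
   shift on both sides preserves agreement on [F]. *)
pose d := (a - w * b) / (2 * w).
have d0 : 0 < d by rewrite divr_gt0 ?subr_gt0 ?mulr_gt0.
have dE : d * (2 * w) = a - w * b by rewrite divfK // gt_eqF ?mulr_gt0.
have pd : psd ((d%:C)%C%:M : 'M[R[i]]_n) by apply: psd_scalar; rewrite ler0c ltW.
exists (A + (d%:C)%C%:M), (B + (d%:C)%C%:M), (a + d), (b + d); split.
- exact: psdD.
- exact: psdD.
- move=> s Fs; rewrite !mulmxDl !raddfD /= AB //; first exact: FL.
  by apply: psd_herm; have [] := Fd _ Fs.
- by rewrite !mulmxDl !raddfD /= mul_scalar_mx linearZ /= rho1 mulr1 aE bE.
- by split; nra.
Qed.

(** * Measure-and-prepare maps and approximation of the target *)

Definition measure_prepare (R : realType) n m (A B : 'M[R[i]]_n)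
    (P Q : 'M[R[i]]_m) (X : 'M[R[i]]_n) : 'M[R[i]]_m :=
  \tr (A *m X) *: P + \tr (B *m X) *: Q.

Lemma sum_pair_form (R : realType) (I J : finType) (f g : I * J -> R[i])
    (T : I -> I -> R[i]) :
  \sum_p \sum_q f p * T p.1 q.1 * g q =
  \sum_a \sum_b (\sum_c f (a, c)) * T a b * (\sum_d g (b, d)).
Proof.
transitivity (\sum_a \sum_c \sum_q f (a, c) * T a q.1 * g q).
  by rewrite [RHS]pair_bigA; apply: eq_bigr => -[].
apply: eq_bigr => a _.
transitivity (\sum_c \sum_b \sum_d f (a, c) * T a b * g (b, d)).
  by apply: eq_bigr => c _; rewrite [RHS]pair_bigA; apply: eq_bigr => -[].
rewrite exchange_big; apply: eq_bigr => b _; rewrite !mulr_suml.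
by apply: eq_bigr => c _; rewrite mulr_sumr.
Qed.

(** Contracting the blocks with the weights [w] gives a psd operator [N], and the form at [w] is the
    trace of [A N]. *)
Lemma psdf_trace_block (R : realType) n (A : 'M[R[i]]_n) k
    (B : 'I_k -> 'I_k -> 'M[R[i]]_n) :
  psd A -> psdf (fun p q : 'I_k * 'I_n => B p.1 q.1 p.2 q.2) ->
  psdf (fun a b => \tr (A *m B a b)).
Proof.
move=> pA pB w.
pose N := \sum_a \sum_b ((w a)^* * w b) *: B a b.
have -> : \sum_a \sum_b (w a)^* * \tr (A *m B a b) * w b = \tr (A *m N).
  rewrite /N mulmx_sumr raddf_sum; apply: eq_bigr => a _ /=.
  rewrite mulmx_sumr raddf_sum; apply: eq_bigr => b _ /=.
  by rewrite -scalemxAr linearZ /= mulrAC.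
apply: psd_trace_mul => // x.
have := pB (fun p => w p.1 * x p.2); congr (_ <= _).
transitivity (\sum_a \sum_i \sum_b \sum_j
   (w a * x i)^* * B a b i j * (w b * x j)).
  rewrite [RHS]pair_bigA; apply: eq_bigr => -[a i] _ /=.
  by rewrite [RHS]pair_bigA; apply: eq_bigr => -[b j].
rewrite exchange_big; apply: eq_bigr => i _.
transitivity (\sum_a \sum_j \sum_b (w a * x i)^* * B a b i j * (w b * x j)).
  by apply: eq_bigr => a _; rewrite exchange_big.
rewrite exchange_big; apply: eq_bigr => j _.
rewrite /N summxE mulr_sumr mulr_suml; apply: eq_bigr => a _.
rewrite summxE mulr_sumr mulr_suml; apply: eq_bigr => b _.
by rewrite mxE rmorphM /=; ring.
Qed.

(** A Gram factor [U] of [P] splits the form into one term per row of [U]; each term is the form of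
    the block-trace kernel at a contracted vector. *)
Lemma cp_trace_scale (R : realType) n m (A : 'M[R[i]]_n) (P : 'M[R[i]]_m) :
  psd A -> psd P -> completely_positive (fun X => \tr (A *m X) *: P).
Proof.
move=> pA /psd_gram[U PE] k B pB v.
have PEij a b : P a b = \sum_h (U h a)^* * U h b.
  by rewrite PE mxE; apply: eq_bigr => h _; rewrite !mxE.
have -> : \sum_p \sum_q (v p)^* * (\tr (A *m B p.1 q.1) *: P) p.2 q.2 * v q =
  \sum_h \sum_p \sum_q (v p * U h p.2)^* * \tr (A *m B p.1 q.1) * (U h q.2 * v q).
  rewrite [RHS]exchange_big; apply: eq_bigr => p _ /=.
  rewrite [RHS]exchange_big; apply: eq_bigr => q _ /=.
  rewrite mxE PEij !mulr_sumr mulr_suml; apply: eq_bigr => h _.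
  by rewrite rmorphM /=; ring.
apply: sumr_ge0 => h _.
rewrite (sum_pair_form (fun p => (v p * U h p.2)^*) (fun q => U h q.2 * v q)
  (fun a b => \tr (A *m B a b))) /=.
have := psdf_trace_block pA pB (fun a => \sum_c U h c * v (a, c)).
congr (_ <= _); apply: eq_bigr => a _; apply: eq_bigr => b _.
rewrite rmorph_sum; congr (_ * _ * _); apply: eq_bigr => c _.
by rewrite mulrC.
Qed.

Lemma cp_measure_prepare (R : realType) n m (A B : 'M[R[i]]_n)
    (P Q : 'M[R[i]]_m) :
  psd A -> psd B -> psd P -> psd Q ->
  completely_positive (measure_prepare A B P Q).
Proof.
move=> pA pB pP pQ k Z pZ v.
have := addr_ge0 (cp_trace_scale pA pP pZ v) (cp_trace_scale pB pQ pZ v).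
congr (_ <= _); rewrite -big_split; apply: eq_bigr => p _ /=.
rewrite -big_split; apply: eq_bigr => q _ /=.
by rewrite [in RHS]mxE -mulrDl -mulrDr.
Qed.

(** Scaling both effects by a small [c > 0] makes the map trace-non-increasing without changing the
    normalized output. No range is asked of [z]: after scaling, the factor is the trace of the image
    of a state, so it lies in [[0,1]]. *)
Lemma measure_prepare_achievable (R : realType) n m (F : set 'M[R[i]]_n)
    (F' : set 'M[R[i]]_m) (rho A B : 'M[R[i]]_n) (P Q : 'M[R[i]]_m) :
  (forall X, F X -> density X) -> (forall X, F' X -> density X) ->
  psd A -> psd B -> psd P -> psd Q ->
  (forall s, F s -> exists s' (z : R),
     F' s' /\ measure_prepare A B P Q s = rsc z s') ->
  0 < \tr (measure_prepare A B P Q rho) ->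
  [set (\tr (E rho))^-1 *: E rho |
     E in [set E | free_ops F F' E /\ 0 < \tr (E rho)]]
    ((\tr (measure_prepare A B P Q rho))^-1 *: measure_prepare A B P Q rho).
Proof.
move=> Fd Fd' pA pB pP pQ AB rho0.
have [cA cA0 cAP] := trace_mul_bound A; have [cB cB0 cBP] := trace_mul_bound B.
have tP := psd_trace_ge0 pP; have tQ := psd_trace_ge0 pQ.
(* [S] bounds the trace gain of the unscaled map; the 1 in [1 + S] keeps the divisor positive. *)
pose S := cA * \tr P + cB * \tr Q.
have S0 : 0 <= S by rewrite addr_ge0 ?mulr_ge0.
have S1 : 0 < 1 + S by rewrite ltr_wpDr.
pose c := (1 + S)^-1.
have c0 : 0 < c by rewrite invr_gt0.
pose E := measure_prepare (c *: A) (c *: B) P Q.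
have EE X : E X = c *: measure_prepare A B P Q X.
  by rewrite /E /measure_prepare -!scalemxAl !linearZ /= -!scalerA -scalerDr.
exists E; last first.
  by rewrite EE mxtraceZ invfM scalerA mulrAC mulVf ?mul1r // gt_eqF.
have Ecp : completely_positive E.
  by apply: cp_measure_prepare => //; apply: psdZ => //; exact: ltW.
have Etr : trace_nonincreasing E.
  move=> X pX; have tX := psd_trace_ge0 pX.
  rewrite EE linearZ /= ler_pdivrMl // raddfD /= !linearZ /=.
  rewrite mulrDl mul1r -[leLHS]add0r lerD //.
  rewrite mulrDl (mulrAC cA) (mulrAC cB) lerD // ler_wpM2r //.
    by apply: le_trans (cAP X pX); rewrite ger0_norm // psd_trace_mul.
  by apply: le_trans (cBP X pX); rewrite ger0_norm // psd_trace_mul.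
split; last by rewrite EE linearZ /= mulr_gt0.
split.
  move=> a X Y; rewrite /E /measure_prepare !mulmxDr -!scalemxAr !mxtraceD !mxtraceZ.
  by rewrite !scalerDl !scalerDr !scalerA addrACA.
do 2![split=> //] => s Fs; have [s' [z [Fs' sE]]] := AB s Fs.
have [ps s1] := Fd _ Fs; have [ps' s'1] := Fd' _ Fs'.
have cE := ge0_Re (ltW c0); set c' := complex.Re _ in cE.
have Es : E s = rsc (c' * z) s'.
  by rewrite EE sE /rsc rmorphM /= -scalerA -cE.
exists s', (c' * z); split=> //; split=> //.
have tE : \tr (E s) = ((c' * z)%:C)%C by rewrite Es trace_rsc s'1 mulr1.
have := Etr s ps; rewrite tE s1 -[1](rmorph1 (real_complex R)) lecR => ->.
rewrite andbT -ler0c -tE /E /measure_prepare raddfD /= !linearZ /=.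
by rewrite addr_ge0 // mulr_ge0 // psd_trace_mul //; apply: psdZ => //; exact: ltW.
Qed.

(** Entries of density operators have modulus at most 1, so mixing with weight [t] moves each real
    or imaginary part by at most [2 t]. *)
Lemma op_closure_mix (R : realType) n (S : set 'M[R[i]]_n) rho :
  density rho ->
  (forall e : R, 0 < e -> exists s (t : R),
     [/\ density s, 0 <= t <= e & S (rsc (1 - t) rho + rsc t s)]) ->
  op_closure S rho.
Proof.
move=> [prho rho1] h.
have /choice[z zP] k : exists z : 'M[R[i]]_n * R,
    [/\ density z.1, 0 <= z.2 <= harmonic k & S (rsc (1 - z.2) rho + rsc z.2 z.1)].
  by have [s [t st]] := h _ (@harmonic_gt0 R k); exists (s, t).
exists (fun k => rsc (1 - (z k).2) rho + rsc (z k).2 (z k).1); split.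
  by move=> k; have [] := zP k.
(* Real and imaginary parts are treated at once through an abstract [g]. *)
have sq (g : R[i] -> R) : (forall (t : R) (x y : R[i]),
      g ((1 - t)%:C%C * x + t%:C%C * y) = (1 - t) * g x + t * g y) ->
    (forall x, ((`|g x|)%:C)%C <= `|x|) -> forall i j,
    g ((rsc (1 - (z k).2) rho + rsc (z k).2 (z k).1) i j) @[k --> \oo]
      --> g (rho i j).
  move=> gl gn i j.
  have g1 X : density X -> `|g (X i j)| <= 1.
    move=> [pX X1]; rewrite -lecR; apply: le_trans (gn _) _.
    by apply: le_trans (psd_entry_le i j pX) _; rewrite X1 rmorph1.
  apply: (@squeeze_cvgr _ _ _ _ (fun k => g (rho i j) - 2 * harmonic k)
            (fun k => g (rho i j) + 2 * harmonic k)).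
  - near=> k; rewrite !mxE gl; have [dz /andP[t0 th] _] := zP k.
    have := g1 _ dz; have := g1 rho (conj prho rho1).
    rewrite !ler_norml; move: (g (rho i j)) (g ((z k).1 i j)) => x y.
    move=> /andP[x1 x2] /andP[y1 y2]; apply/andP.
    by move: t0 th; move: (z k).2 (harmonic k) => t e t0 th; split; nra.
  - rewrite -[X in _ --> X]subr0; apply: cvgB; first exact: cvg_cst.
    rewrite -[X in _ --> X](mulr0 2).
    by apply: cvgM; [exact: cvg_cst|exact: cvg_harmonic].
  - rewrite -[X in _ --> X]addr0; apply: cvgD; first exact: cvg_cst.
    rewrite -[X in _ --> X](mulr0 2).
    by apply: cvgM; [exact: cvg_cst|exact: cvg_harmonic].
move=> i j; split; apply: sq.
- by move=> t x y; rewrite ReD !ReM /= !mul0r !subr0.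
- exact: normc_ge_Re.
- by move=> t x y; rewrite ImD !ImM /= !mul0r !addr0.
- exact: normIm_le.
Unshelve. all: by end_near. Qed.

(** * Supports of states and domination *)

Lemma qform_bound (R : realType) n (W : 'M[R[i]]_n) :
  exists2 c : R[i], 0 <= c & forall w : 'cV[R[i]]_n,
    `|(w ^t* *m W *m w) 0 0| <= c * (w ^t* *m w) 0 0.
Proof.
have [c c0 cP] := trace_mul_bound W; exists c => // w.
have pw : psd (w *m w ^t*) by have := psd_gramR (w ^t*); rewrite trmxCK.
have <- : \tr (W *m (w *m w ^t*)) = (w ^t* *m W *m w) 0 0.
  by rewrite -trace_mx11 mulmxA mxtrace_mulC mulmxA.
by rewrite -(trace_mx11 (w ^t* *m w)) (mxtrace_mulC (w ^t*)); exact: cP.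
Qed.

(* If the range of rho lies in that of s then rho = s W s, and s^2 <= c s. *)
Lemma psd_dominated (R : realType) n (rho s : 'M[R[i]]_n) :
  psd rho -> psd s -> (rho <= s)%MS -> exists l : R, loewner rho (rsc l s).
Proof.
move=> prho ps sub.
(* Range inclusion gives [rho = (rho G) s], and by adjunction [rho = s (rho G)^*]; hence
   [s W s = rho G s = rho]. *)
pose G := pinvmx s; pose W := (rho *m G) ^t* *m G.
have rhoE : rho = s *m W *m s.
  have e := mulmxKpV sub.
  have e' : s *m (rho *m G) ^t* = rho.
    by rewrite -{1}(psd_herm ps) -adjmxM e psd_herm.
  by rewrite /W mulmxA e' e.
have [c c0 cP] := qform_bound W.
have [U sE] := psd_gram ps.
have [c' c'0 c'P] := qform_bound (U *m U ^t*).
have cc : c * c' = ((complex.Re (c * c'))%:C)%C by apply: ge0_Re; exact: mulr_ge0.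
exists (complex.Re (c * c')); apply/psdP => v.
have /psdP/(_ v) q0 := prho.
rewrite /rsc -cc mulmxBr mulmxBl -scalemxAr -scalemxAl.
have -> (M N : 'M[R[i]]_1) : (M - N) 0 0 = M 0 0 - N 0 0 by rewrite !mxE.
have -> (a : R[i]) (M : 'M[R[i]]_1) : (a *: M) 0 0 = a * M 0 0 by rewrite mxE.
rewrite subr_ge0 -(ger0_norm q0).
have e1 : v ^t* *m rho *m v = (s *m v) ^t* *m W *m (s *m v).
  by rewrite {1}rhoE adjmxM psd_herm // !mulmxA.
have e2 : (s *m v) ^t* *m (s *m v) = (U *m v) ^t* *m (U *m U ^t*) *m (U *m v).
  by rewrite sE !adjmxM trmxCK !mulmxA.
have e3 : v ^t* *m s *m v = (U *m v) ^t* *m (U *m v).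
  by rewrite sE adjmxM !mulmxA.
rewrite e1; apply: le_trans (cP _) _; rewrite -mulrA ler_wpM2l // e2 e3.
apply: le_trans (c'P _); apply: real_ler_norm; rewrite -e2.
by rewrite ger0_real // -trace_mx11 adjmx_self_trace_ge0.
Qed.

(** The columns of [cokermx t] lie in the kernel of [t], so [s] kills them, which is the criterion
    [submxE]. *)
Lemma ker_submx (R : realType) n (s t : 'M[R[i]]_n) :
  (forall v : 'cV[R[i]]_n, t *m v = 0 -> s *m v = 0) -> (s <= t)%MS.
Proof.
move=> h; rewrite submxE; apply/eqP/matrixP => i j.
have : s *m (cokermx t *m delta_mx j 0) = 0 :> 'cV[R[i]]_n.
  by apply: h; rewrite mulmxA mulmx_coker mul0mx.
by rewrite mulmxA -colE => /colP/(_ i); rewrite !mxE.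
Qed.

(** Take [s0] of maximal rank. The midpoint of [s0] and [s] is free and its kernel lies in both
    kernels, so its row space contains both; by maximality it is that of [s0]. *)
Lemma max_support (R : realType) n (F : set 'M[R[i]]_n) :
  affine_free_set F -> exists2 s0, F s0 & forall s, F s -> (s <= s0)%MS.
Proof.
move=> [[sF FsF] [_ [Fcv [Fd _]]]].
pose P k := `[< exists2 s, F s & \rank s = k >].
have exP : exists k, P k by exists (\rank sF); apply/asboolP; exists sF.
have ubP k : P k -> (k <= n)%N by move=> /asboolP[s _ <-]; exact: rank_leq_row.
case: (ex_maxnP exP ubP) => d /asboolP[s0 Fs0 rs0] dmax.
exists s0 => // s Fs.
have [ps0 _] := Fd _ Fs0; have [ps _] := Fd _ Fs.
have h2 : 0 < 2^-1 :> R by rewrite invr_gt0.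
pose t := rsc 2^-1 s0 + rsc (1 - 2^-1) s.
have h3 : 0 < 1 - 2^-1 :> R by rewrite subr_gt0 invf_lt1 // ltr1n.
have Ft : F t by apply: Fcv => //; rewrite ltW //=; lra.
have kert (v : 'cV[R[i]]_n) : t *m v = 0 -> s0 *m v = 0 /\ s *m v = 0.
  move=> tv; have : (v ^t* *m t *m v) 0 0 = 0 by rewrite -mulmxA tv mulmx0 mxE.
  rewrite /t /rsc mulmxDr mulmxDl -!scalemxAr -!scalemxAl.
  have -> (a b : R[i]) (M N : 'M[R[i]]_1) :
    (a *: M + b *: N) 0 0 = a * M 0 0 + b * N 0 0 by rewrite !mxE.
  have /psdP/(_ v) q0 := ps0; have /psdP/(_ v) q1 := ps.
  move=> /eqP; rewrite paddr_eq0; first last.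
  - by apply: mulr_ge0 => //; rewrite ler0c ltW.
  - by apply: mulr_ge0 => //; rewrite ler0c ltW.
  rewrite !mulf_eq0 !fmorph_eq0 (gt_eqF h2) (gt_eqF h3) /=.
  by move=> /andP[/eqP ? /eqP ?]; split; exact: psd_qform_eq0.
have s0t : (s0 <= t)%MS by apply: ker_submx => v /kert[].
have st : (s <= t)%MS by apply: ker_submx => v /kert[].
apply: submx_trans st _; have [_] := mxrank_leqif_sup s0t.
by rewrite eqn_leq (mxrankS s0t) rs0 dmax //; apply/asboolP; exists t.
Qed.

(** * Construction of the transformation in each case *)

Lemma rscA (R : realType) n (a b : R) (X : 'M[R[i]]_n) :
  rsc a (rsc b X) = rsc (a * b) X.
Proof. by rewrite /rsc scalerA rmorphM. Qed.

Lemma loewner_mono (R : realType) n (X s : 'M[R[i]]_n) (l y : R) :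
  psd s -> loewner X (rsc l s) -> l <= y -> loewner X (rsc y s).
Proof.
move=> ps Xl ly; rewrite /loewner.
have -> : rsc y s - X = (rsc l s - X) + rsc (y - l) s.
  by apply/matrixP => i j; rewrite /rsc !mxE; ring.
by apply: psdD => //; apply: psd_rsc => //; rewrite subr_ge0.
Qed.

Lemma density_mix (R : realType) n (X Y : 'M[R[i]]_n) (t : R) :
  density X -> density Y -> 0 <= t <= 1 ->
  density (rsc (1 - t) X + rsc t Y).
Proof.
move=> [pX X1] [pY Y1] /andP[t0 t1]; split.
  by apply: psdD; apply: psd_rsc => //; rewrite subr_ge0.
by rewrite mxtraceD !trace_rsc X1 Y1 !mulr1 -rmorphD subrK rmorph1.
Qed.

Lemma prob_transformation_RF_infty (R : realType) n m (F : set 'M[R[i]]_n)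
    (F' : set 'M[R[i]]_m) rho rho' :
  affine_free_set F -> affine_free_set F' -> density rho -> density rho' ->
  RF F rho = +oo%E -> prob_transformation F F' rho rho'.
Proof.
move=> aF aF' [prho rho1] drho' RFoo; have [prho' rho'1] := drho'.
have [_ [_ [_ [Fd _]]]] := aF; have [[s' Fs'] [_ [_ [Fd' _]]]] := aF'.
have [s0 Fs0 s0max] := max_support aF.
have nsub : ~ (rho <= s0)%MS.
  have [ps0 _] := Fd _ Fs0; move=> /(psd_dominated prho ps0)[l rl].
  have : (RF F rho <= l%:E)%E.
    apply: (@le_trans _ _ (Rmax rho s0)); apply: ereal_inf_lbound; first by exists s0.
    by exists l.
  by rewrite RFoo leye_eq.
have [v s0v rv] : exists2 v : 'cV[R[i]]_n, s0 *m v = 0 & rho *m v <> 0.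
  apply: contra_notP nsub => h; apply: ker_submx => v s0v.
  by apply: contra_notP h => rv; exists v.
pose A := v *m v ^t*.
have pA : psd A by have := psd_gramR (v ^t*); rewrite trmxCK.
have trA X : \tr (A *m X) = (v ^t* *m X *m v) 0 0.
  by rewrite -trace_mx11 /A -mulmxA mxtrace_mulC.
have Arho : 0 < \tr (A *m rho).
  rewrite lt_def psd_trace_mul // andbT; apply/negP => /eqP.
  by rewrite trA => /(psd_qform_eq0 prho).
have mpE X : measure_prepare A 0 rho' 0 X = \tr (A *m X) *: rho'.
  by rewrite /measure_prepare scaler0 addr0.
(* Mixing weight 0: the target is reached exactly. *)
apply: op_closure_mix => // e e0; exists rho', 0; split=> //.
  by rewrite lexx ltW.
have := @measure_prepare_achievable R n m F F' rho A 0 rho' 0 Fd Fd' pA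
  (@psd0 _ _) prho' (@psd0 _ _).
rewrite mpE mxtraceZ rho'1 mulr1 scalerA mulVf ?gt_eqF // scale1r.
rewrite /rsc subr0 rmorph1 rmorph0 scale0r addr0 scale1r; apply=> // s Fs.
(* Free states are sent to zero, that is, to probability 0 times an arbitrary free state. *)
exists s', 0; split=> //; rewrite mpE trA.
have /submxP[D ->] := s0max s Fs.
by rewrite -!mulmxA s0v !mulmx0 mxE /rsc rmorph0 !scale0r.
Qed.

(** Here the target is a limit of free states, and discarding the input to prepare a nearby free [s]
    suffices. This case is separate because the general construction needs a gap [w0 - 1 > 0]. *)
Lemma prob_transformation_Omega_le1 (R : realType) n m (F : set 'M[R[i]]_n)
    (F' : set 'M[R[i]]_m) rho rho' :
  affine_free_set F -> affine_free_set F' -> density rho -> density rho' ->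
  (OmegaF F' rho' <= 1%:E)%E -> prob_transformation F F' rho rho'.
Proof.
move=> aF aF' [prho rho1] drho' O1; have [prho' rho'1] := drho'.
have [_ [_ [_ [Fd _]]]] := aF; have [_ [_ [_ [Fd' _]]]] := aF'.
apply: op_closure_mix => // e e0.
have e1 : 0 < 1 + e by lra.
have [|s [l [k [Fs rl _ [l1 k1] lk]]]] := @Omega_lt_witness _ _ F' rho' (1 + e) Fd' drho'.
  by apply: le_lt_trans O1 _; rewrite lte_fin ltrDl.
have [ps s1] := Fd' _ Fs.
have le : l <= 1 + e by nra.
have rle := loewner_mono ps rl le.
(* Since [rho' <= (1 + e) s], the normalized remainder [tau] is a state, and [s] is the mixture of
   [rho'] and [tau] with weight [e / (1 + e)] on [tau]. *)
pose tau := rsc e^-1 (rsc (1 + e) s - rho').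
have dtau : density tau.
  split; first by apply: psd_rsc => //; rewrite invr_ge0 ltW.
  rewrite trace_rsc raddfB /= trace_rsc s1 rho'1 mulr1.
  by rewrite -(rmorph1 (real_complex R)) -rmorphB -rmorphM /= addrAC subrr add0r
    mulVf ?gt_eqF.
pose t := e / (1 + e).
have tE : t * (1 + e) = e by rewrite divfK // gt_eqF.
exists tau, t; split=> //; first by apply/andP; split; nra.
have -> : rsc (1 - t) rho' + rsc t tau = s.
  have e' : (1 - t) = (1 + e)^-1 by rewrite /t; field; rewrite gt_eqF.
  have e'' : t * e^-1 = (1 + e)^-1 by rewrite /t; field; rewrite !gt_eqF.
  rewrite /tau rscA e' e'' /rsc scalerBr scalerA addrCA subrr addr0.
  by rewrite -rmorphM mulVf ?gt_eqF // rmorph1 scale1r.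
have mpE X : measure_prepare (1%:M) 0 s 0 X = \tr X *: s :> 'M[R[i]]_m.
  by rewrite /measure_prepare scaler0 addr0 mul1mx.
have := @measure_prepare_achievable R n m F F' rho 1%:M 0 s 0 Fd Fd'
  (@psd_scalar R n 1 ler01) (@psd0 _ _) ps (@psd0 _ _).
rewrite mpE mxtraceZ rho1 s1 mulr1 invr1 !scale1r; apply=> // s2 Fs2.
exists s, 1; split=> //; rewrite mpE; have [_ ->] := Fd _ Fs2.
by rewrite /rsc rmorph1.
Qed.

(** Agreement of [A] and [B] on [F] cancels [tau] in the output, since [P + Q = (y - x) s']. On
    [rho] the last two inequalities make the weights of [tau] and [s'] positive and nonnegative; [t]
    is the normalized weight of [s']. *)
Lemma two_outcome_achievable (R : realType) n m (F : set 'M[R[i]]_n)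
    (F' : set 'M[R[i]]_m) (rho A B : 'M[R[i]]_n) (a b x y : R)
    (tau s' : 'M[R[i]]_m) :
  affine_free_set F -> affine_free_set F' -> psd A -> psd B ->
  (forall s, F s -> \tr (A *m s) = \tr (B *m s)) ->
  \tr (A *m rho) = (a%:C)%C -> \tr (B *m rho) = (b%:C)%C ->
  density tau -> F' s' -> loewner (rsc x s') tau -> loewner tau (rsc y s') ->
  b < a -> a * x <= b * y ->
  let t := (b * y - a * x) / (a - b + (b * y - a * x)) in
  [set (\tr (E rho))^-1 *: E rho |
     E in [set E | free_ops F F' E /\ 0 < \tr (E rho)]]
    (rsc (1 - t) tau + rsc t s').
Proof.
move=> aF aF' pA pB AB aE bE [ptau tau1] Fs' pP pQ ba axby t.
have [_ [_ [_ [Fd _]]]] := aF; have [_ [_ [_ [Fd' _]]]] := aF'.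
have [ps' s'1] := Fd' _ Fs'.
pose P := tau - rsc x s'; pose Q := rsc y s' - tau.
set d := b * y - a * x in t *.
have N0 : 0 < a - b + d by rewrite ltr_wpDr ?subr_gt0 // subr_ge0.
have mpE : measure_prepare A B P Q rho = rsc (a - b) tau + rsc d s'.
  rewrite /measure_prepare aE bE /P /Q /d.
  by apply/matrixP => i j; rewrite /rsc !mxE; ring.
have trE : \tr (measure_prepare A B P Q rho) = ((a - b + d)%:C)%C.
  by rewrite mpE mxtraceD !trace_rsc tau1 s'1 !mulr1 -rmorphD.
have := @measure_prepare_achievable R n m F F' rho A B P Q Fd Fd' pA pB pP pQ.
have -> : (\tr (measure_prepare A B P Q rho))^-1 *: measure_prepare A B P Q rho
    = rsc (1 - t) tau + rsc t s'.
  rewrite trE mpE -fmorphV scalerDr -!/(rsc _ _) !rscA.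
  by congr (rsc _ _ + rsc _ _); rewrite /t; field; rewrite gt_eqF.
rewrite trE ltcR; apply=> // s Fs; have [ps _] := Fd _ Fs.
exists s', (complex.Re (\tr (A *m s)) * (y - x)); split=> //.
rewrite /measure_prepare -AB // -scalerDr -rscA.
rewrite {1}(ge0_Re (psd_trace_mul pA ps)) -/(rsc _ (P + Q)); congr (rsc _ _).
by apply/matrixP => i j; rewrite /rsc /P /Q !mxE; ring.
Qed.

Lemma prob_transformation_Omega_fin (R : realType) n m (F : set 'M[R[i]]_n)
    (F' : set 'M[R[i]]_m) rho rho' (w0 : R) :
  affine_free_set F -> affine_free_set F' -> density rho -> density rho' ->
  1 < w0 -> OmegaF F rho = w0%:E -> (OmegaF F' rho' <= w0%:E)%E ->
  prob_transformation F F' rho rho'.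
Proof.
move=> aF aF' drho drho' w01 Ow Ow'.
have [_ [_ [_ [Fd' _]]]] := aF'.
apply: op_closure_mix => // e e0.
pose r := (w0 - 1) / 2.
have r0 : 0 < r by rewrite divr_gt0 ?subr_gt0.
have rE : r * 2 = w0 - 1 by rewrite divfK.
(* [e' <= r] keeps [w0 - e' >= 1 + r], whence [a - b >= b r]; [2 e' <= e r] then makes an [s']
   weight of at most [2 b e'] negligible. *)
pose e' := Num.min r (e * r / 2).
have e'0 : 0 < e' by rewrite lt_min r0 /= divr_gt0 // mulr_gt0.
have e'r : e' <= r by rewrite ge_min lexx.
have e'e : e' * 2 <= e * r by rewrite -ler_pdivlMr // ge_min lexx orbT.
have [||A [B [a [b [pA pB AB [aE bE] [b0 wba]]]]]] :=
    @Omega_dual _ _ F rho (w0 - e') aF drho.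
- by lra.
- by rewrite Ow lte_fin ltrBlDr ltrDl.
have [|s' [l [k [Fs' rl sk [l1 k1] lk]]]] :=
    @Omega_lt_witness _ _ F' rho' (w0 + e') Fd' drho'.
  by apply: le_lt_trans Ow' _; rewrite lte_fin ltrDl.
have ds' := Fd' _ Fs'; have [ps' _] := ds'.
have k0 : 0 < k by lra.
pose x := k^-1.
have xk : x * k = 1 by rewrite mulVf // gt_eqF.
have x0 : 0 < x by rewrite invr_gt0.
have x1 : x <= 1 by nra.
(* [y >= l] makes [Q] psd, and [y >= x a / b] makes the weight of [s'] nonnegative. *)
pose y := Num.max l (x * a / b).
have ba : b < a by nra.
have ybE : x * a / b * b = x * a by rewrite divfK // gt_eqF.
have axby : a * x <= b * y.
  by rewrite (mulrC a) -ybE (mulrC b) ler_pM2r // le_max lexx orbT.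
exists s', ((b * y - a * x) / (a - b + (b * y - a * x))); split=> //; last first.
  apply: (@two_outcome_achievable _ _ _ F F' rho A B) => //.
    rewrite /loewner.
    have -> : rho' - rsc x s' = rsc x (rsc k rho' - s').
      by rewrite /rsc scalerBr scalerA -rmorphM xk rmorph1 scale1r.
    exact: psd_rsc (ltW x0) sk.
  by apply: loewner_mono rl _ => //; rewrite le_max lexx.
have d0 : 0 <= b * y - a * x by rewrite subr_ge0.
have N0 : 0 < a - b + (b * y - a * x) by lra.
apply/andP; split; first by rewrite divr_ge0 // ltW.
rewrite ler_pdivrMr //.
have dle : b * y - a * x <= b * (e' * 2).
  have v0 : 0 <= b * (e' * 2) by rewrite !mulr_ge0 // ltW.
  rewrite /y; case: (leP l (x * a / b)) => _.
    by rewrite [b * _]mulrC ybE [a * x]mulrC subrr.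
  (* The bounds [l k < w0 + e'] and [(w0 - e') b < a] leave a gap of at most [2 e' b]. *)
  have u1 : b * (l * k) - a <= b * (e' * 2).
    have : b * (l * k) <= b * (w0 + e') by rewrite ler_pM2l // ltW.
    by lra.
  have -> : b * l - a * x = x * (b * (l * k) - a).
    by rewrite mulrBr mulrCA (mulrCA x) xk mulr1 [x * a]mulrC.
  have : x * (b * (l * k) - a) <= x * (b * (e' * 2)) by rewrite ler_pM2l.
  move=> /le_trans; apply; exact: ler_piMl.
have abr : b * r <= a - b by nra.
have : b * (e' * 2) <= b * (e * r) by rewrite ler_pM2l.
have : e * (b * r) <= e * (a - b) by rewrite ler_pM2l.
have : 0 <= e * (b * y - a * x) by rewrite mulr_ge0 // ltW.
by lra.
Qed.

(** An infinite Omega allows [a / b] to be arbitrarily large. Mixing [s'] into the target with small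
    weight [x] gives [tau >= x s'], and [y = a x / b] then cancels the [s'] term, so [tau] is
    produced exactly. *)
Lemma prob_transformation_Omega_infty (R : realType) n m (F : set 'M[R[i]]_n)
    (F' : set 'M[R[i]]_m) rho rho' :
  affine_free_set F -> affine_free_set F' -> density rho -> density rho' ->
  OmegaF F rho = +oo%E -> (RF F' rho' < +oo)%E ->
  prob_transformation F F' rho rho'.
Proof.
move=> aF aF' drho drho' Ooo /ereal_inf_lt[_ [s' Fs' <-]].
move=> /ereal_inf_lt[_ [l rl <-] _].
have [_ [_ [_ [Fd' _]]]] := aF'; have ds' := Fd' _ Fs'; have [ps' _] := ds'.
have l1 := loewner_density_ge1 drho' ds' rl.
have [prho' _] := drho'.
apply: op_closure_mix => // e e0.
pose x := Num.min e 1.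
have x0 : 0 < x by rewrite lt_min e0 ltr01.
have x1 : x <= 1 by rewrite ge_min lexx orbT.
(* With this ratio [a / b > w] yields [y = a x / b >= l], as needed for [tau <= y s']. *)
pose w := l / x.
have wx : w * x = l by rewrite divfK // gt_eqF.
have w1 : 1 <= w by rewrite ler_pdivlMr // mul1r; lra.
have [|A [B [a [b [pA pB AB [aE bE] [b0 wba]]]]]] :=
    @Omega_dual _ _ F rho w aF drho w1.
  by rewrite Ooo ltry.
exists s', x; split=> //; first by rewrite ltW //= ge_min lexx.
set tau := _ + _.
have dtau : density tau by apply: density_mix => //; rewrite (ltW x0).
pose y := a * x / b.
have yb : b * y = a * x by rewrite mulrC divfK // gt_eqF.
have ly : l <= y by rewrite ler_pdivlMr //; nra.
have ba : b < a by nra.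
have := @two_outcome_achievable _ _ _ F F' rho A B a b x y tau s' aF aF' pA pB AB
  aE bE dtau Fs'.
have mix0 : rsc (1 - 0) tau + rsc 0 s' = tau.
  by rewrite subr0 /rsc rmorph1 rmorph0 scale1r scale0r addr0.
rewrite yb subrr mul0r /= mix0; apply=> //.
  by rewrite /loewner /tau addrK; apply: psd_rsc => //; rewrite subr_ge0.
apply: loewner_mono ly => //; rewrite /loewner.
have -> : rsc l s' - tau = rsc (1 - x) (rsc l s' - rho') + rsc (x * (l - 1)) s'.
  by rewrite /tau; apply/matrixP => i j; rewrite /rsc !mxE; ring.
apply: psdD; apply: psd_rsc => //; first by rewrite subr_ge0.
by rewrite mulr_ge0 ?subr_ge0 // ltW.
Qed.

Local Open Scope ereal_scope.

Theorem theorem3 (R : realType) (n m : nat)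
    (F : set 'M[R[i]]_n) (F' : set 'M[R[i]]_m)
    (rho : 'M[R[i]]_n) (rho' : 'M[R[i]]_m) :
  affine_free_set F -> affine_free_set F' ->
  density rho -> density rho' ->
  ((OmegaF F rho < +oo /\ OmegaF F' rho' <= OmegaF F rho) \/
   (OmegaF F rho = +oo /\ RF F' rho' < +oo) \/
   RF F rho = +oo) ->
  prob_transformation F F' rho rho'.
Proof.
move=> aF aF' drho drho' [[fin le]|[[]|]].
- case O : (OmegaF F rho) fin le => [w| |] // _ le.
    have [w1|w1] := leP w 1%R.
      by apply: prob_transformation_Omega_le1 => //; apply: le_trans le _; rewrite lee_fin.
    exact: prob_transformation_Omega_fin w1 O le.
  (* The formal value [-oo] falls under the same bound by 1. *)
  by apply: prob_transformation_Omega_le1 => //; apply: le_trans le _; rewrite leNye.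
- exact: prob_transformation_Omega_infty.
- exact: prob_transformation_RF_infty.
Qed.
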